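(* Let $\mathcal{X}$ and $A$ be finite sets, and let $F_a:\mathbb{N}\times\mathcal{X}\times\mathbb{R}^A\times\mathbb{R}^{\mathbb{N}\times\mathcal{X}}\to\mathbb{R}$, $a\in A$, satisfy the monotonicity and regularity assumptions (1) and (2) in the context. Let $c\in\mathbb{R}^{\mathcal{X}\times A}$ with $c>0$ (every component is positive), let $\{Q_n\}_{n\in\mathbb{N}}\subset\mathbb{R}^{\mathcal{X}\times\mathcal{X}}$ be substochastic matrices, and let $\mathcal{M}$ be the associated inspection operator defined in the context. Suppose $u:\mathbb{N}\times\mathcal{X}\to\mathbb{R}^A$ is bounded and satisfies $$\min\big\{F_a(n,x,u(n,x),u_a),\ u_a(n,x)-\mathcal{M}u(n,x)\big\}\le 0\quad\text{for all } n\in\mathbb{N},\ x\in\mathcal{X},\ a\in A,$$ and $v:\mathbb{N}\times\mathcal{X}\to\mathbb{R}^A$ is bounded and satisfies $$\min\big\{F_a(n,x,v(n,x),v_a),\ v_a(n,x)-\mathcal{M}v(n,x)\big\}\ge 0\quad\text{for all } n\in\mathbb{N},\ x\in\mathcal{X},\ a\in A.$$ Then $u\le v$, i.e. $u_a(n,x)\le v_a(n,x)$ for all $n,x,a$.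
   Context: $\mathbb{N}=\{1,2,\dots\}$ (time elapsed since last observation). For $u:\mathbb{N}\times\mathcal{X}\to\mathbb{R}^A$, $u_a:\mathbb{N}\times\mathcal{X}\to\mathbb{R}$ denotes its $a$-th component, and $u^n_{a,x}=u_a(n,x)$. Inequalities between functions or vectors are componentwise; adding a scalar to a function means adding it to all values. A substochastic matrix has nonnegative entries and row sums bounded by $1$. The inspection operator is $$\mathcal{M}u(n,x)=\big(Q_n\,\overline{u^1-c}\big)_x,\qquad \big(\overline{u^1-c}\big)_x=\max_{a\in A}\big(u^1_{a,x}-c_{a,x}\big).$$ Assumptions on $\{F_a\}_{a\in A}$: (1) There exists $\beta>0$ such that for any $n\in\mathbb{N}$, $x\in\mathcal{X}$, $a\in A$, any bounded functions $u,v:\mathbb{N}\times\mathcal{X}\to\mathbb{R}^A$ with $u\le v$, and any $r,s\in\mathbb{R}^A$ with $\theta:=r_a-s_a=\max_{j\in A}(r_j-s_j)\ge0$, $$F_a(n,x,r,u_a+\theta)-F_a(n,x,s,v_a)\ge\beta\theta.$$ (2) For any $n\in\mathbb{N}$, $a\in A$, $r\in\mathbb{R}^A$ and continuous bounded $\phi:\mathbb{N}\times\mathcal{X}\to\mathbb{R}$, the function $x\mapsto F_a(n,x,r,\phi)$ is continuous and bounded. Moreover, the functions $r\mapsto F_a(n,x,r,\phi)$ are uniformly continuous for bounded $r$, uniformly with respect to $(n,x)\in\mathbb{N}\times\mathcal{X}$. (Finite sets and $\mathbb{N}$ carry the discrete topology.) *)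

(* Defs.v *)
From HB Require Import structures.
From mathcomp Require Import all_boot all_order all_algebra.
From mathcomp Require Import all_classical all_reals all_analysis.

Set Implicit Arguments.
Unset Strict Implicit.
Unset Printing Implicit Defensive.

Import Order.TTheory GRing.Theory Num.Theory.
Import numFieldNormedType.Exports.

Local Open Scope classical_set_scope.
Local Open Scope ring_scope.

(* N = {1, 2, ...}, with the discrete topology. *)
Definition posint : Type := discrete_topology {n : nat | (0 < n)%N}.

Definition posint1 : posint := exist (fun n : nat => (0 < n)%N) 1%N isT.

(* The index set A may be empty, so its maximum is taken as a supremum;
   finmaxP shows that it is the maximum as soon as A is inhabited. *)
Definition finmax (R : realType) (A : finType) (f : A -> R) : R := sup (range f).

Lemma finmaxP (R : realType) (A : finType) (a0 : A) (f : A -> R) :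
  (exists a, finmax f = f a) /\ (forall a, f a <= finmax f).
Proof.
have [b _ fb] : exists2 b, true & forall a, f a <= f b.
  by case: (@arg_maxP _ R A a0 predT f isT) => b _ fb; exists b => // a; exact: fb.
have ub : has_ubound (range f) by exists (f b) => _ [a _ <-]; exact: fb.
have fmax a : f a <= finmax f by apply: ub_le_sup => //; exists a.
split=> //; exists b; apply/eqP; rewrite eq_le fmax andbT.
by apply: ge_sup; [exists (f b), b | move=> _ [a _ <-]; exact: fb].
Qed.

(* A function u : N x X -> R^A is represented as u : posint * X -> A -> R. *)
Definition component (R : realType) (X A : finType) (u : posint * X -> A -> R) (a : A) :
    posint * X -> R :=
  fun p => u p a.

Definition bounded_vec (R : realType) (X A : finType) (u : posint * X -> A -> R) :
    Prop :=
  forall a : A, bounded_fun (component u a).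

Definition substochastic (R : realType) (X : finType) (Q : X -> X -> R) : Prop :=
  (forall x y : X, 0 <= Q x y) /\ (forall x : X, \sum_(y : X) Q x y <= 1).

Definition inspection (R : realType) (X A : finType) (Q : posint -> X -> X -> R)
    (c : X -> A -> R) (u : posint * X -> A -> R) (n : posint) (x : X) : R :=
  \sum_(y : X) Q n x y * finmax (fun a : A => u (posint1, y) a - c y a).

Definition monotonicity (R : realType) (X A : finType)
    (F : A -> posint -> X -> (A -> R) -> (posint * X -> R) -> R) : Prop :=
  exists2 beta : R, 0 < beta &
    forall (n : posint) (x : X) (a : A) (u v : posint * X -> A -> R) (r s : A -> R)
           (theta : R),
      bounded_vec u -> bounded_vec v ->
      (forall (p : posint * X) (j : A), u p j <= v p j) ->
      theta = r a - s a ->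
      theta = finmax (fun j : A => r j - s j) ->
      0 <= theta ->
      beta * theta <=
        F a n x r (fun p => component u a p + theta) - F a n x s (component v a).

(* In the second clause the modulus of continuity may depend on a, phi and the
   bound K on r, but not on (n, x); R^A carries the sup norm. *)
Definition regularity (R : realType) (X A : finType)
    (F : A -> posint -> X -> (A -> R) -> (posint * X -> R) -> R) : Prop :=
  forall (a : A) (phi : posint * discrete_topology X -> R),
    continuous phi -> bounded_fun phi ->
    (forall (n : posint) (r : A -> R),
       continuous (fun x : discrete_topology X => F a n x r phi) /\
       bounded_fun (fun x : X => F a n x r phi)) /\
    (forall K eps : R, 0 < eps ->
       exists2 delta : R, 0 < delta &
         forall (n : posint) (x : X) (r s : A -> R),
           (forall j : A, `|r j| <= K) -> (forall j : A, `|s j| <= K) ->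
           (forall j : A, `|r j - s j| < delta) ->
           `|F a n x r phi - F a n x s phi| < eps).

(* Main.v *)
Require Import Defs.
From mathcomp Require Import all_boot all_order all_algebra.
From mathcomp Require Import all_classical all_reals all_analysis.
From mathcomp Require Import lra.

(** A comparison principle through the supremum of the gap u - v.
Suppose M, the supremum of u_a(n,x) - v_a(n,x) over all n, x, a, is positive.

Where the subsolution satisfies F_a <= 0, monotonicity compares u - M, which
lies below v, with v, and produces a gain beta * M that contradicts F_a >= 0
for v.  This argument wants the gap to equal M at the point considered, and
the supremum over the infinite time axis need not be attained; moving the
single coordinate u_a(n,x) up to v_a(n,x) + M repairs this, and the uniform
modulus of continuity of F_a absorbs the move when the gap is close to M.
Hence such points have a gap bounded away from M (running_gap).

So all points with gap close to M are inspecting points of u, where the gap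
is at most a substochastic average of the gaps of the maxima of u^1 - c and
v^1 - c, and hence at most the larger of 0 and the maximal gap at time 1.  As
there are finitely many states and actions, M is attained at time 1.

Among the points at time 1 where M is attained, take one with u as large as
possible.  It is an inspecting point, so averaging forces the weights to
sum to 1 and to charge only states whose gap is again M; one of these has
u - c at least as large as the maximal u, which c > 0 forbids
(no_inspecting_contact). *)

Set Implicit Arguments.
Unset Strict Implicit.
Unset Printing Implicit Defensive.

Import Order.TTheory GRing.Theory Num.Theory.
Import numFieldNormedType.Exports.

Local Open Scope ring_scope.

(** * Maxima, bounds and continuity *)

Lemma finmax_eq (R : realType) (A : finType) (a : A) (f : A -> R) :
  (forall j, f j <= f a) -> finmax f = f a.
Proof.
move=> fa; have [[b fb] fmax] := finmaxP a f.
by apply/eqP; rewrite eq_le fmax fb fa.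
Qed.

Lemma bounded_funE_bound (R : realType) (T : Type) (f : T -> R) :
  bounded_fun f <-> exists K : R, forall t, `|f t| <= K.
Proof.
split.
  by move=> /(pinfty_ex_gt (num_real 0)) [K _ fK]; exists K => t; exact: fK.
move=> [K fK]; exists K; split; first exact: num_real.
by move=> K' KK' t _; exact: le_trans (fK t) (ltW KK').
Qed.

Lemma bounded_vec_bound (R : realType) (X A : finType) (a0 : A)
    (u : posint * X -> A -> R) :
  bounded_vec u -> exists K : R, forall p j, `|u p j| <= K.
Proof.
move=> bu.
have /choice[K uK] : forall j, exists K : R, forall p, `|u p j| <= K.
  by move=> j; apply/bounded_funE_bound; exact: bu.
exists (finmax K) => p j; exact: le_trans (uK j p) ((finmaxP a0 K).2 j).
Qed.

(** Regularity speaks of continuous arguments; here every function is one,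
since a product of two discrete spaces is discrete. *)
Lemma continuous_discrete_prod (R : realType) (X : finType)
    (phi : posint * discrete_topology X -> R) : continuous phi.
Proof.
move=> [n x] B /nbhs_singleton Bphi.
exists ([set n]%classic, [set x]%classic).
  by split; exact: discrete_set1.
by move=> [m y] /= [-> ->].
Qed.

(** * Points where the subsolution satisfies F <= 0 *)

(** Monotonicity, applied to u - M <= v with theta = M, needs a vector r whose
excess over v(n,x) is maximal at a with value exactly M.  The vector u(n,x)
with its a-th entry replaced by v_a(n,x) + M is one, and it is
delta-close to u(n,x) as soon as the gap at (n,x,a) exceeds M - delta. Then
F_a at u(n,x) differs from F_a at r by less than the gain beta * M. *)
Lemma running_gap (R : realType) (X A : finType)
    (F : A -> posint -> X -> (A -> R) -> (posint * X -> R) -> R)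
    (u v : posint * X -> A -> R) (M : R) (a : A) :
  monotonicity F -> regularity F -> bounded_vec u -> bounded_vec v ->
  (forall p j, u p j - v p j <= M) -> 0 < M ->
  exists2 delta : R, 0 < delta & forall n x,
    F a n x (u (n, x)) (component u a) <= 0 ->
    0 <= F a n x (v (n, x)) (component v a) ->
    u (n, x) a - v (n, x) a <= M - delta.
Proof.
move=> [beta beta0 mono] reg bu bv uvM M0.
have [Ku uK] := bounded_vec_bound a bu.
have [Kv vK] := bounded_vec_bound a bv.
(* Ku + Kv + M bounds both u(n,x) and the modified vector r below. *)
have [_ modulus] := reg a (component u a) (@continuous_discrete_prod _ _ _) (bu a).
have [delta delta0 Fdelta] := modulus (Ku + Kv + M) _ (mulr_gt0 beta0 M0).
exists delta => // n x Fu Fv; rewrite leNgt; apply/negP => near_top.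
pose r j := if j == a then v (n, x) a + M else u (n, x) j.
have Ku0 : 0 <= Ku := le_trans (normr_ge0 _) (uK (n, x) a).
have Kv0 : 0 <= Kv := le_trans (normr_ge0 _) (vK (n, x) a).
have ra : r a = v (n, x) a + M by rewrite /r eqxx.
have rs_le j : r j - v (n, x) j <= r a - v (n, x) a.
  rewrite ra; rewrite /r; case: eqP => [->//|_].
  by have := uvM (n, x) j; lra.
pose u' (p : posint * X) (j : A) := u p j - M.
have bu' : bounded_vec u'.
  move=> j; apply/bounded_funE_bound; exists (Ku + M) => p.
  rewrite /component /u'; apply: le_trans (ler_normB _ _) _.
  by apply: lerD; [exact: uK|rewrite ger0_norm// ltW].
have u'v p j : u' p j <= v p j by rewrite /u'; have := uvM p j; lra.
have Mra : M = r a - v (n, x) a by rewrite ra; lra.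
have := mono n x a u' v r (v (n, x)) M bu' bv u'v Mra _ (ltW M0).
rewrite (finmax_eq (a := a)) // => /(_ Mra).
rewrite (_ : (fun p => component u' a p + M) = component u a); last first.
  by apply/funext => p; rewrite /component /u' subrK.
have := Fdelta n x r (u (n, x)).
have rK j : `|r j| <= Ku + Kv + M.
  rewrite /r; case: eqP => _.
    by apply: le_trans (ler_normD _ _) _; rewrite (gtr0_norm M0); have := vK (n, x) a; lra.
  by have := uK (n, x) j; lra.
have uK' j : `|u (n, x) j| <= Ku + Kv + M by have := uK (n, x) j; lra.
have ru j : `|r j - u (n, x) j| < delta.
  rewrite /r; case: eqP => [->|_]; last by rewrite subrr normr0.
  by have := uvM (n, x) a; rewrite ltr_norml; lra.
by move=> /(_ rK uK' ru); rewrite ltr_norml => /andP[_]; lra.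
Qed.

(** The maximizer of f - c serves as a competitor for g - c, so the cost cancels.
Its first property is kept because the position of the maximum, and
the cost paid there, matter for contact points. *)
Lemma finmax_gap (R : realType) (A : finType) (a0 : A) (f g c : A -> R) :
  exists b, finmax (fun a => f a - c a) = f b - c b /\
    finmax (fun a => f a - c a) - finmax (fun a => g a - c a) <= f b - g b.
Proof.
have [[b fb] _] := finmaxP a0 (fun a => f a - c a).
exists b; split=> //; rewrite fb.
by have := (finmaxP a0 (fun a => g a - c a)).2 b; lra.
Qed.

(** * Substochastic averages and inspection *)

Lemma substochastic_sum_le (R : realType) (X : finType) (Q : X -> X -> R)
    (f : X -> R) (m : R) (x : X) :
  substochastic Q -> 0 <= m -> (forall y, f y <= m) ->
  \sum_y Q x y * f y <= m.
Proof.
move=> [Q0 Q1] m0 fm; apply: (@le_trans _ _ (\sum_y Q x y * m)).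
  by apply: ler_sum => y _; exact: ler_wpM2l.
by rewrite -mulr_suml ler_piMl.
Qed.

(** The deficit M - f is nonnegative and its average is at most
(the total weight - 1) * M <= 0, so nothing can be lost: neither mass, which
is where M > 0 enters, nor height on the states that are charged. *)
Lemma substochastic_contact (R : realType) (X : finType) (Q : X -> X -> R)
    (f : X -> R) (M : R) (x : X) :
  substochastic Q -> 0 < M -> (forall y, f y <= M) ->
  M <= \sum_y Q x y * f y ->
  \sum_y Q x y = 1 /\ forall y, 0 < Q x y -> f y = M.
Proof.
move=> [Q0 Q1] M0 fM Mf.
have gap0 y : 0 <= Q x y * (M - f y) by rewrite mulr_ge0 // subr_ge0.
have gapE : \sum_y Q x y * (M - f y) = (\sum_y Q x y) * M - \sum_y Q x y * f y.
  by rewrite mulr_suml -sumrB; apply: eq_bigr => y _; rewrite mulrBr.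
have gap_ge0 : 0 <= \sum_y Q x y * (M - f y) by exact: sumr_ge0.
have QM : (\sum_y Q x y) * M <= M by rewrite ler_piMl // ltW.
have QM1 : (\sum_y Q x y) * M = 1 * M by lra.
split; first exact: (mulIf (lt0r_neq0 M0) QM1).
move=> y Qy.
have /eqP : \sum_y Q x y * (M - f y) = 0 by lra.
rewrite psumr_eq0 // => /allP /(_ y (mem_index_enum y)) /=.
by rewrite mulf_eq0 gt_eqF //= subr_eq0 => /eqP.
Qed.

Lemma weighted_sum_le_term (R : realType) (X : finType) (q g : X -> R) (U : R) :
  (forall y, 0 <= q y) -> \sum_y q y = 1 -> U <= \sum_y q y * g y ->
  exists2 y, 0 < q y & U <= g y.
Proof.
move=> q0 q1 Ug; apply: contrapT => none.
have term_le y : 0 <= q y * (U - g y).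
  have [Uy|/ltW yU] := leP U (g y); last by rewrite mulr_ge0 // subr_ge0.
  have [qy|qy] := ltP 0 (q y); first by case: none; exists y.
  by rewrite (_ : q y = 0) ?mul0r //; apply/eqP; rewrite eq_le qy q0.
have sumE : \sum_y q y * (U - g y) = U - \sum_y q y * g y.
  by under eq_bigr do rewrite mulrBr; rewrite sumrB -mulr_suml q1 mul1r.
have sum_ge0 : 0 <= \sum_y q y * (U - g y) by exact: sumr_ge0.
have /eqP : \sum_y q y * (U - g y) = 0 by lra.
rewrite psumr_eq0 // => /allP zero.
suff : \sum_y q y = 0 by rewrite q1 => /eqP; rewrite oner_eq0.
apply: big1 => y _; apply/eqP; have := zero y (mem_index_enum y).
rewrite /= mulf_eq0 subr_eq0 => /orP[//|/eqP Uy].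
rewrite eq_le q0 andbT leNgt; apply/negP => qy.
by case: none; exists y; rewrite // Uy.
Qed.

Lemma inspectionB (R : realType) (X A : finType) (Q : posint -> X -> X -> R)
    (c : X -> A -> R) (u v : posint * X -> A -> R) (n : posint) (x : X) :
  inspection Q c u n x - inspection Q c v n x =
  \sum_y Q n x y * (finmax (fun a => u (posint1, y) a - c y a)
                    - finmax (fun a => v (posint1, y) a - c y a)).
Proof. by rewrite /inspection -sumrB; apply: eq_bigr => y _; rewrite mulrBr. Qed.

(** * The supremum of the gap *)

(** Fixing the action a at which the supremum is approached, before letting
the time vary, is what makes a modulus depending on a sufficient. *)
Lemma sup_gap (R : realType) (X A : finType) (x0 : X) (a0 : A)
    (u v : posint * X -> A -> R) :
  bounded_vec u -> bounded_vec v ->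
  exists (M : R) (a : A), (forall p j, u p j - v p j <= M) /\
    forall e, 0 < e -> exists p, M - e < u p a - v p a.
Proof.
move=> bu bv.
have [Ku uK] := bounded_vec_bound a0 bu.
have [Kv vK] := bounded_vec_bound a0 bv.
pose D a := range (fun p => u p a - v p a).
have D_has_sup a : has_sup (D a).
  split; first by exists (u (posint1, x0) a - v (posint1, x0) a), (posint1, x0).
  exists (Ku + Kv) => _ [p _ <-].
  have := uK p a; have := vK p a; rewrite !ler_norml; lra.
have [[a Ma] Mmax] := finmaxP a0 (fun a => sup (D a)).
exists (finmax (fun a => sup (D a))), a; split=> [p j|e e0].
  apply: le_trans (Mmax j); apply: ub_le_sup; first exact: (D_has_sup j).2.
  by exists p.
rewrite Ma; have [_ [p _ <-] lt_p] := sup_adherent e0 (D_has_sup a).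
by exists p.
Qed.

(** If inspection were always optimal for u where the gap equals M, one would
pass from such a state to another of the same kind with strictly larger
u, each inspection having to recover its positive cost; finitely many
states and actions exclude this. *)
Lemma no_inspecting_contact (R : realType) (X A : finType)
    (c : X -> A -> R) (Q : posint -> X -> X -> R) (u v : posint * X -> A -> R)
    (M : R) :
  (forall x a, 0 < c x a) -> substochastic (Q posint1) -> 0 < M ->
  (forall p j, u p j - v p j <= M) ->
  (forall x a, u (posint1, x) a - v (posint1, x) a = M ->
     u (posint1, x) a <= inspection Q c u posint1 x /\
     inspection Q c v posint1 x <= v (posint1, x) a) ->
  forall x a, u (posint1, x) a - v (posint1, x) a <> M.
Proof.
move=> c0 Qsub M0 uvM contact x0 a0 /eqP contact0.
pose gap (z : X * A) := u (posint1, z.1) z.2 - v (posint1, z.1) z.2.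
have [[x a] /= /eqP xaM top] :=
  @arg_maxP _ R (X * A)%type (x0, a0) (fun z => gap z == M)
    (fun z => u (posint1, z.1) z.2) contact0.
have [uI vI] := contact _ _ xaM.
have gap_le y : finmax (fun a => u (posint1, y) a - c y a)
    - finmax (fun a => v (posint1, y) a - c y a) <= M.
  have [b [_ le_b]] := finmax_gap a0 (u (posint1, y)) (v (posint1, y)) (c y).
  exact: le_trans le_b (uvM _ _).
have sumM : M <= \sum_y Q posint1 x y *
    (finmax (fun a => u (posint1, y) a - c y a)
     - finmax (fun a => v (posint1, y) a - c y a)).
  by rewrite -inspectionB -xaM /gap /=; lra.
have [Q1 contactQ] := substochastic_contact Qsub M0 gap_le sumM.
have [y Qy le_y] := weighted_sum_le_term (Qsub.1 x) Q1 uI.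
have [b [ub le_b]] := finmax_gap a0 (u (posint1, y)) (v (posint1, y)) (c y).
have yb : gap (y, b) == M.
  by rewrite eq_le uvM /=; rewrite contactQ in le_b.
by have := top _ yb; have := c0 y b; rewrite /=; lra.
Qed.

Theorem proposition3p3 (R : realType) (X A : finType)
    (F : A -> posint -> X -> (A -> R) -> (posint * X -> R) -> R)
    (c : X -> A -> R) (Q : posint -> X -> X -> R)
    (u v : posint * X -> A -> R) :
  monotonicity F ->
  regularity F ->
  (forall (x : X) (a : A), 0 < c x a) ->
  (forall n : posint, substochastic (Q n)) ->
  bounded_vec u ->
  (forall (n : posint) (x : X) (a : A),
     Num.min (F a n x (u (n, x)) (component u a))
             (u (n, x) a - inspection Q c u n x) <= 0) ->
  bounded_vec v ->
  (forall (n : posint) (x : X) (a : A),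
     0 <= Num.min (F a n x (v (n, x)) (component v a))
                  (v (n, x) a - inspection Q c v n x)) ->
  forall (n : posint) (x : X) (a : A), u (n, x) a <= v (n, x) a.
Proof.
move=> mono reg c0 Qsub bu subsol bv supersol n0 x0 a0.
rewrite leNgt; apply/negP => vu.
have [M [a [uvM adherent]]] := sup_gap x0 a0 bu bv.
have M0 : 0 < M by have := uvM (n0, x0) a0; lra.
have inspects j : exists2 delta : R, 0 < delta & forall n x,
    M - delta < u (n, x) j - v (n, x) j ->
    u (n, x) j <= inspection Q c u n x /\ inspection Q c v n x <= v (n, x) j.
  have [delta delta0 run] := running_gap j mono reg bu bv uvM M0.
  exists delta => // n x gap.
  have := supersol n x j; rewrite le_min subr_ge0 => /andP[Fv vI].
  have := subsol n x j; rewrite ge_min subr_le0 => /orP[Fu|//].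
  by have := run n x Fu Fv; rewrite leNgt gap.
pose gap1 (z : X * A) := u (posint1, z.1) z.2 - v (posint1, z.1) z.2.
have no_contact : forall x j, gap1 (x, j) <> M.
  apply: (no_inspecting_contact c0 (Qsub posint1) M0 uvM) => x j jM.
  by have [delta delta0 insp] := inspects j; apply: insp; rewrite jM; lra.
(* m bounds the average gap after an inspection; the 0 is there because a
   substochastic average of negative gaps may be larger than all of them. *)
pose m := finmax (fun z => Num.max 0 (gap1 z)).
have [[z mz] mmax] := finmaxP (x0, a0) (fun z => Num.max 0 (gap1 z)).
have mM : m < M.
  rewrite /m mz gt_max M0 lt_neqAle uvM andbT.
  by apply/eqP; case: z {mz} => x j; exact: no_contact.
have m0 : 0 <= m by rewrite /m mz le_max lexx.
have gap1m y j : gap1 (y, j) <= m by apply: le_trans (mmax (y, j)); rewrite le_max lexx orbT.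
have [delta delta0 insp] := inspects a.
(* Within delta of M the point is inspecting, within M - m its gap exceeds m. *)
have e0 : 0 < Num.min delta (M - m) by rewrite lt_min delta0 subr_gt0.
have [[n x] near_top] := adherent _ e0.
have e_delta : Num.min delta (M - m) <= delta by rewrite ge_min lexx.
have e_m : Num.min delta (M - m) <= M - m by rewrite ge_min lexx orbT.
have [uI vI] : u (n, x) a <= inspection Q c u n x /\
    inspection Q c v n x <= v (n, x) a by apply: insp; lra.
have : inspection Q c u n x - inspection Q c v n x <= m.
  rewrite inspectionB; apply: substochastic_sum_le => // y.
  have [b [_ le_b]] := finmax_gap a0 (u (posint1, y)) (v (posint1, y)) (c y).
  exact: le_trans le_b (gap1m y b).
lra.
Qed.
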